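(* For any finite simple graph $G$, $$\dim_R(G)-1=\dim_L(G)\le \dim_H(G)=\dim_P(\overline{G})-1 .$$
   Context: $\overline G$ is the complement of $G$. A clique $k$-cover of $G$ is a family of cliques of $G$ such that every edge of $G$ lies in at least one of them and every vertex belongs to at most $k$ of them. The rank dimension $\dim_R(G)$ is the minimal positive integer $k$ such that $G$ has a clique $k$-cover (equivalently, $G$ is isomorphic to the intersection graph of the edges of a hypergraph all of whose edges have size at most $k$). The Lebesgue dimension of $G$ is defined as $\dim_L(G)=\dim_R(G)-1$. The categorical product $G_1\times G_2$ has vertex set $V(G_1)\times V(G_2)$, with $(u_1,u_2),(v_1,v_2)$ adjacent iff $u_1v_1\in E(G_1)$ and $u_2v_2\in E(G_2)$. The Prague dimension $\dim_P(H)$ is the minimal positive integer $d$ such that $H$ is isomorphic to an induced subgraph of a categorical product of $d$ complete graphs. The Hausdorff dimension of $G$ is $\dim_H(G)=\min\{s:\mathcal{H}^s(G)<\infty\}-1$, with $s$ ranging over positive integers, where $\mathcal{H}^s(G)$ is the $s$-measure of $G$; it is a finite number if $\overline{G}$ is isomorphic to an induced subgraph of the $s$-fold categorical power $(K_N)^s$ for some $N$, and it is $+\infty$ otherwise. *)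

(* Defs.v *)
From HB Require Import structures.
From mathcomp Require Import all_boot all_order all_algebra.
From mathcomp Require Import boolp reals constructive_ereal.

Set Implicit Arguments.
Unset Strict Implicit.
Unset Printing Implicit Defensive.

Record sgraph := SGraph {
  vertex :> finType;
  adj : rel vertex;
  adj_sym : symmetric adj;
  adj_irr : irreflexive adj }.

Section Constructions.
Variables G H : sgraph.

Definition compl_rel : rel G := fun x y => (x != y) && ~~ adj x y.

Lemma compl_sym : symmetric compl_rel.
Proof. by move=> x y; rewrite /compl_rel eq_sym adj_sym. Qed.

Lemma compl_irr : irreflexive compl_rel.
Proof. by move=> x; rewrite /compl_rel eqxx. Qed.

Definition compl : sgraph := SGraph compl_sym compl_irr.

Definition gprod_rel : rel (G * H)%type :=
  fun u v => adj u.1 v.1 && adj u.2 v.2.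

Lemma gprod_sym : symmetric gprod_rel.
Proof.
by move=> u v; rewrite /gprod_rel adj_sym [adj u.2 _]adj_sym.
Qed.

Lemma gprod_irr : irreflexive gprod_rel.
Proof. by move=> u; rewrite /gprod_rel adj_irr. Qed.

Definition gprod : sgraph := SGraph gprod_sym gprod_irr.

Variable S : {set G}.

Definition induced_rel : rel {x : G | x \in S} :=
  fun u v => adj (val u) (val v).

Lemma induced_sym : symmetric induced_rel.
Proof. by move=> u v; rewrite /induced_rel adj_sym. Qed.

Lemma induced_irr : irreflexive induced_rel.
Proof. by move=> u; rewrite /induced_rel adj_irr. Qed.

Definition induced : sgraph := SGraph induced_sym induced_irr.

Definition isomorphic : Prop :=
  exists2 f : G -> H, bijective f & forall x y, adj (f x) (f y) = adj x y.

End Constructions.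

Definition neq_rel (n : nat) : rel 'I_n := fun i j => i != j.

Lemma neq_sym n : symmetric (@neq_rel n).
Proof. by move=> i j; rewrite /neq_rel eq_sym. Qed.

Lemma neq_irr n : irreflexive (@neq_rel n).
Proof. by move=> i; rewrite /neq_rel eqxx. Qed.

Definition complete (n : nat) : sgraph := SGraph (@neq_sym n) (@neq_irr n).

Definition embeds (H K : sgraph) : Prop :=
  exists S : {set K}, isomorphic H (induced S).

(* The s-fold categorical power, meaningful only for s > 0: the empty
   categorical product would be a loop, which is not a simple graph. *)
Definition gpow (G : sgraph) (s : nat) : sgraph := iter s.-1 (gprod G) G.

Lemma embedsP (H K : sgraph) (f : H -> K) :
  injective f -> (forall x y, adj (f x) (f y) = adj x y) -> embeds H K.
Proof.
move=> f_inj f_adj; exists [set f x | x in H].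
have fP x : f x \in [set f z | z in H] by apply: imset_f.
exists (fun x => exist _ (f x) (fP x)); last by move=> x y; apply: f_adj.
have gP (u : {y | y \in [set f z | z in H]}) : exists x, f x == val u.
  by case/imsetP: (valP u) => x _ ->; exists x.
exists (fun u => xchoose (gP u)) => [x | u].
  by apply: f_inj; apply/eqP; apply: (xchooseP (gP _)).
by apply: val_inj; apply/eqP; apply: (xchooseP (gP u)).
Qed.

Definition clique (G : sgraph) (A : {set G}) : bool :=
  [forall x in A, forall y in A, (x != y) ==> adj x y].

Definition clique_cover (G : sgraph) (k : nat) (F : {set {set G}}) : bool :=
  [&& [forall A in F, clique A],
      [forall x, forall y, adj x y ==>
         [exists A in F, (x \in A) && (y \in A)]] &
      [forall x, #|[set A in F | x \in A]| <= k]].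

Lemma rank_dim_exists (G : sgraph) :
  exists k, (0 < k) && [exists F, clique_cover (G := G) k F].
Proof.
exists #|{set G}|.+1; apply/andP; split=> //; apply/existsP.
exists [set A | clique A]; apply/and3P; split.
- by apply/forallP=> A; apply/implyP; rewrite inE.
- apply/forallP=> x; apply/forallP=> y; apply/implyP=> xy.
  apply/existsP; exists [set x; y]; rewrite !inE !eqxx orbT !andbT.
  apply/forallP=> a; apply/implyP; rewrite !inE => ha.
  apply/forallP=> b; apply/implyP; rewrite !inE => hb; apply/implyP.
  by case/orP: ha => /eqP->; case/orP: hb => /eqP->;
    rewrite ?eqxx // adj_sym.
- by apply/forallP=> x; apply: leqW; apply: max_card.
Qed.

Definition rank_dim (G : sgraph) : nat := ex_minn (rank_dim_exists G).

Definition lebesgue_dim (G : sgraph) : nat := rank_dim G - 1.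

Definition in_complete_power (H : sgraph) (s : nat) : Prop :=
  exists N : nat, embeds H (gpow (complete N) s).

(* The d factors are complete N :: map complete Ns, hence d = (size Ns).+1. *)
Definition in_complete_product (H : sgraph) (d : nat) : Prop :=
  exists (N : nat) (Ns : seq nat),
    d = (size Ns).+1 /\
    embeds H (foldr gprod (complete N) [seq complete n | n <- Ns]).

Lemma complete_power_exists (H : sgraph) :
  exists2 s, 0 < s & in_complete_power H s.
Proof.
pose r (x : H) : 'I_#|H| := enum_rank x.
pose g (p : H * H) (x : H) := r (if x == p.2 then p.1 else x).
pose ps := [seq p <- enum {: H * H} | (p.1 != p.2) && ~~ adj p.1 p.2].
have pow (l : seq (H * H)) :
    exists2 F : H -> iter (size l) (gprod (complete #|H|)) (complete #|H|),
      injective F & forall x y, adj (F x) (F y) =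
        all (fun p => g p x != g p y) l && (x != y).
  elim: l => [|p l [F F_inj F_adj]].
    exists r; first exact: enum_rank_inj.
    by move=> x y /=; rewrite /neq_rel (inj_eq enum_rank_inj).
  exists (fun x => (g p x, F x)); first by move=> x y [_ /F_inj].
  by move=> x y /=; rewrite /gprod_rel /= F_adj andbA.
have [F F_inj F_adj] := pow ps.
exists (size ps).+1 => //; exists #|H|; apply: (@embedsP _ _ F) => // x y.
rewrite F_adj; apply/andP/idP => [[/allP sep xy] | xy].
  apply: contraT => nadj; have: (x, y) \in ps.
    by rewrite mem_filter /= xy nadj mem_enum.
  by move/sep; rewrite /g /= eqxx (negPf xy) eqxx.
have nxy : x != y by apply: contraL xy => /eqP->; rewrite adj_irr.
split=> //; apply/allP=> -[a b]; rewrite mem_filter /= => /andP[/andP[ab nab] _].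
rewrite /g /= (inj_eq enum_rank_inj).
case: (eqVneq x b) => [xb|_]; case: (eqVneq y b) => [yb|_] //.
- by rewrite xb yb eqxx in nxy.
- by apply: contraNneq nab => ->; rewrite -xb adj_sym.
- by apply: contraNneq nab => <-; rewrite -yb.
Qed.

Lemma in_complete_power_product (H : sgraph) (s : nat) :
  0 < s -> in_complete_power H s -> in_complete_product H s.
Proof.
case: s => // s _ [N HN]; exists N, (nseq s N); rewrite size_nseq; split=> //.
suff -> : foldr gprod (complete N) [seq complete n | n <- nseq s N]
        = gpow (complete N) s.+1 by [].
by rewrite /gpow /=; elim: s {HN} => //= s ->.
Qed.

Lemma prague_dim_exists (H : sgraph) :
  exists d, (0 < d) && `[< in_complete_product H d >].
Proof.
have [s s0 Hs] := complete_power_exists H.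
by exists s; rewrite s0; apply/asboolP; apply: in_complete_power_product.
Qed.

Definition prague_dim (H : sgraph) : nat := ex_minn (prague_dim_exists H).

Section Hausdorff.
Variables (R : realType) (vol : nat -> sgraph -> R).

(* [vol s G] is the value of the s-measure of G when that measure is finite.
   It is kept arbitrary: the Hausdorff dimension only depends on the set of s
   for which the s-measure is finite. *)
Definition smeasure (s : nat) (G : sgraph) : \bar R :=
  if `[< in_complete_power (compl G) s >] then (vol s G)%:E else +oo%E.

Lemma hausdorff_dim_exists (G : sgraph) :
  exists s, (0 < s) && (smeasure s G < +oo)%E.
Proof.
have [s s0 Hs] := complete_power_exists (compl G).
by exists s; rewrite s0 /smeasure asboolT // ltry.
Qed.

Definition hausdorff_dim (G : sgraph) : nat :=
  ex_minn (hausdorff_dim_exists G) - 1.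

End Hausdorff.

(* Main.v *)
(* A vertex of a power of complete graphs is a tuple of coordinates, and two
   vertices are adjacent iff they differ in every coordinate.  If the complement
   of [G] lies in such an [s]-th power, the fibres of the [s] coordinates are
   cliques of [G]: they cover every edge, since adjacent vertices of [G] agree in
   some coordinate, and every vertex is in at most [s] of them, one for each
   coordinate.  The equality of the Hausdorff and Prague dimensions holds because
   the factors of a product of complete graphs can all be enlarged to a common
   one. *)
Require Import Defs.
From mathcomp Require Import all_boot all_order all_algebra.
From mathcomp Require Import boolp reals constructive_ereal.

Set Implicit Arguments.
Unset Strict Implicit.
Unset Printing Implicit Defensive.

Definition graph_embedding (H K : sgraph) (f : H -> K) : Prop :=
  injective f /\ forall x y, adj (f x) (f y) = adj x y.

(** Embeddings seen as maps can be composed and paired without tracking the vertex subset that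
    [embeds] quantifies over. *)
Lemma embedsE (H K : sgraph) :
  embeds H K <-> exists f : H -> K, graph_embedding f.
Proof.
split=> [[S [f f_bij f_adj]] | [f [f_inj f_adj]]]; last exact: embedsP f_adj.
exists (fun x => val (f x)); split; last exact: f_adj.
exact: inj_comp val_inj (bij_inj f_bij).
Qed.

Lemma embeds_trans (H K L : sgraph) : embeds H K -> embeds K L -> embeds H L.
Proof.
move=> /embedsE[f [f_inj f_adj]] /embedsE[g [g_inj g_adj]].
apply/embedsE; exists (g \o f); split; first exact: inj_comp.
by move=> x y; rewrite /= g_adj f_adj.
Qed.

Lemma embeds_gprod (H H' K K' : sgraph) :
  embeds H H' -> embeds K K' -> embeds (gprod H K) (gprod H' K').
Proof.
move=> /embedsE[f [f_inj f_adj]] /embedsE[g [g_inj g_adj]].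
apply/embedsE; exists (fun p => (f p.1, g p.2)).
split=> [[a b] [c d] /= [/f_inj-> /g_inj->] // | x y].
by rewrite /= /gprod_rel f_adj g_adj.
Qed.

Lemma embeds_complete (m n : nat) :
  m <= n -> embeds (complete m) (complete n).
Proof.
move=> le_mn; apply/embedsE; exists (widen_ord le_mn).
have w_inj : injective (widen_ord le_mn) by move=> i j [/val_inj].
by split=> // i j; rewrite /= /neq_rel (inj_eq w_inj).
Qed.

Lemma in_complete_product_power (H : sgraph) (d : nat) :
  in_complete_product H d -> in_complete_power H d.
Proof.
move=> [N [Ns [-> HNs]]].
have [M] : exists M, all (leq^~ M) (N :: Ns).
  (* The largest factor size serves as the common size. *)
  by exists (\max_(n <- N :: Ns) n); apply/allP=> n nNs; apply: leq_bigmax_seq.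
case/andP=> leNM leNsM; exists M; apply: embeds_trans HNs _; rewrite /gpow /=.
elim: Ns leNsM => [|n Ns IHNs] /=.
  by move=> _; apply: embeds_complete.
case/andP=> /embeds_complete le_n /IHNs leNs.
exact: embeds_gprod.
Qed.

(** Vertices of [gpow] are nested pairs; this makes their coordinates accessible by an index. *)
Lemma gpow_complete_coordinates (N s : nat) :
  exists c : (s.+1).-tuple (gpow (complete N) s.+1 -> 'I_N),
    forall x y, adj x y = [forall i, tnth c i x != tnth c i y].
Proof.
(* Stated with [all], the property unfolds along the tuple in step with the nested pairs. *)
suff [c cP] : exists c : (s.+1).-tuple (gpow (complete N) s.+1 -> 'I_N),
    forall x y, adj x y = all (fun f => f x != f y) c.
  by exists c => x y; rewrite cP; apply/all_tnthP/forallP.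
elim: s => [|s [c cP]].
  by exists [tuple of [:: id]] => x y; rewrite /= andbT.
exists [tuple of fst :: [seq f \o snd | f <- c]] => x y.
by rewrite /= all_map /gprod_rel cP.
Qed.

Lemma rank_dim_le_power (G : sgraph) (s : nat) :
  0 < s -> in_complete_power (compl G) s -> rank_dim G <= s.
Proof.
case: s => // s _ [N /embedsE[f [_ f_adj]]].
have [c cP] := gpow_complete_coordinates N s.
pose fibre i x := [set y : G | tnth c i (f y) == tnth c i (f x)].
have adjP (x y : G) :
    (x != y) && ~~ adj x y = [forall i, tnth c i (f x) != tnth c i (f y)].
  by rewrite -cP f_adj.
rewrite /rank_dim; case: ex_minnP => k _; apply; apply/existsP.
exists [set fibre p.1 p.2 | p : 'I_s.+1 * G]; apply/and3P; split.
- apply/forall_inP=> _ /imsetP[[i x] _ ->].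
  apply/forall_inP=> y; rewrite inE => /eqP yx.
  apply/forall_inP=> z; rewrite inE => /eqP zx.
  (* Distinct non-adjacent [y] and [z] would be adjacent in the complement, hence differ in
     coordinate [i]. *)
  apply/implyP=> yz; apply: contraT => nadj.
  have: (y != z) && ~~ adj y z by rewrite yz.
  by rewrite adjP => /forallP/(_ i); rewrite yx zx eqxx.
- apply/forallP=> x; apply/forallP=> y; apply/implyP=> xy.
  have: ~~ ((x != y) && ~~ adj x y) by rewrite xy andbF.
  rewrite adjP negb_forall => /existsP[i]; rewrite negbK => /eqP cxy.
  apply/existsP; exists (fibre i x); rewrite !inE cxy eqxx !andbT.
  by apply/imsetP; exists (i, x).
(* A fibre [fibre i z] containing [x] equals [fibre i x], so the sets through [x] are indexed by [i]
   alone. *)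
- apply/forallP=> x; rewrite -[leqRHS]card_ord.
  apply: leq_trans (leq_imset_card (fibre^~ x) 'I_s.+1).
  apply/subset_leq_card/subsetP=> A; rewrite inE => /andP[].
  case/imsetP=> -[i z] _ -> /=; rewrite inE => /eqP cxz.
  by apply/imsetP; exists i => //; apply/setP=> y; rewrite !inE cxz.
Qed.

(** The values of [vol] are real, so only the [+oo] branch is infinite. *)
Lemma smeasure_lty (R : realType) (vol : nat -> sgraph -> R) (s : nat)
    (G : sgraph) :
  (smeasure vol s G < +oo)%E = `[< in_complete_power (compl G) s >].
Proof. by rewrite /smeasure; case: ifP => _; rewrite ?ltry ?ltxx. Qed.

Theorem proposition5 (R : realType) (vol : nat -> sgraph -> R) (G : sgraph) :
  rank_dim G - 1 = lebesgue_dim G /\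
  lebesgue_dim G <= hausdorff_dim vol G /\
  hausdorff_dim vol G = prague_dim (compl G) - 1.
Proof.
rewrite /hausdorff_dim /prague_dim; split=> //.
case: ex_minnP => s /andP[s_gt0]; rewrite smeasure_lty => /asboolP Gs s_min.
split; first by apply: leq_sub2r; apply: rank_dim_le_power.
case: ex_minnP => d /andP[d_gt0 /asboolP Gd] d_min.
(* Each minimum is admissible for the other minimization. *)
congr (_ - 1); apply/eqP; rewrite eqn_leq; apply/andP; split.
  apply: s_min; rewrite d_gt0 smeasure_lty.
  by apply/asboolP/in_complete_product_power.
by apply: d_min; rewrite s_gt0; apply/asboolP/in_complete_power_product.
Qed.
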